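(* Let $d\ge 2$, let $\Pi=\{\Pi_1,\ldots,\Pi_k\}$ be a rank-$1$ POVM on $\mathbb{C}^d$ with associated unit vectors $\varphi_1,\ldots,\varphi_k\in\mathbb{C}^d$, and let $W$ be a non-trivial linear subspace of $\mathbb{C}^d$. Then for every $i\in\{1,\ldots,k\}$ we have $$\Pi_i(W)\subset W\iff \varphi_i\in W\cup W^\perp.$$
   Context: A POVM on $\mathbb{C}^d$ with $k$ outcomes is a set $\{\Pi_1,\ldots,\Pi_k\}$ of non-zero positive semi-definite operators on $\mathbb{C}^d$ with $\sum_{i=1}^k\Pi_i=\mathbb{I}$. It is called a (normalised) rank-$1$ POVM if $\operatorname{tr}\Pi_1=\cdots=\operatorname{tr}\Pi_k$ and $\operatorname{rank}\Pi_i=1$ for every $i$; then necessarily $\operatorname{tr}\Pi_i=d/k$ and $k\ge d$, and there are unit vectors $\varphi_1,\ldots,\varphi_k\in\mathbb{C}^d$ (the vectors associated with $\Pi$) such that $\Pi_i=\frac dk\rho_i$, where $\rho_i$ is the orthogonal projection onto $\operatorname{span}\{\varphi_i\}$. A subspace of $\mathbb{C}^d$ is non-trivial if it is neither $\{0\}$ nor $\mathbb{C}^d$. *)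

(* Defs.v *)
From mathcomp Require Import all_boot all_order all_algebra.
From mathcomp Require Import complex reals.

Set Implicit Arguments.
Unset Strict Implicit.
Unset Printing Implicit Defensive.

Import Order.TTheory GRing.Theory Num.Theory.
Local Open Scope ring_scope.

(* Vectors of C^d are row vectors, and a matrix A stands for the operator
   u |-> u *m A, so that [dotmx], [orthov] and [proj_ortho] apply as they are. *)

Section Povm.
Variables (C : numClosedFieldType) (d k : nat).
Implicit Types (A : 'M[C]_d) (W : {vspace 'rV[C]_d}).
Implicit Types (Pi : 'I_k -> 'M[C]_d) (phi : 'I_k -> 'rV[C]_d).

Definition op A : 'End('rV[C]_d) := linfun (mulmxr A).

Definition orthocompl W : {vspace 'rV[C]_d} := orthov (@dotmx C d) W.

Definition psd A : Prop :=
  A \is hermsymmx /\ forall u : 'rV[C]_d, 0 <= dotmx (op A u) u.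

Definition povm Pi : Prop :=
  [/\ forall i, Pi i != 0,
      forall i, psd (Pi i)
    & \sum_i Pi i = 1%:M].

Definition rank1_povm Pi : Prop :=
  [/\ povm Pi,
      forall i j, \tr (Pi i) = \tr (Pi j)
    & forall i, \rank (Pi i) = 1%N].

(* [proj_ortho (phi i)] is the orthogonal projection onto the row space of the
   one-row matrix [phi i], that is, onto the line spanned by [phi i]. *)
Definition associated_vectors Pi phi : Prop :=
  forall i, dotmx (phi i) (phi i) = 1 /\
            Pi i = (d%:R / k%:R) *: proj_ortho (phi i).

End Povm.

(* Main.v *)
Require Import Defs.
From mathcomp Require Import all_boot all_order all_algebra.
From mathcomp Require Import complex reals.
Import Order.TTheory GRing.Theory Num.Theory.
Local Open Scope ring_scope.

(** Up to the non-zero factor d/k, an element of a rank-1 POVM is the projection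
    w |-> <w, v> v onto the line of a unit vector v ([mulmx_proj_ortho_unit]).
    Its image of a subspace W is therefore 0 when every w in W is orthogonal to
    v, that is, when v lies in the orthogonal complement of W, and the whole
    line of v otherwise. In the first case W is trivially invariant; in the
    second it is invariant exactly when it contains v. This dichotomy is
    [proj_ortho_stable]. *)

(** The residue w - <w, v> v is orthogonal to v, so the sum of this residue and
    of <w, v> v is the decomposition of w along the line of v and its orthogonal
    complement. *)
Lemma mulmx_proj_ortho_unit (C : numClosedFieldType) (d : nat)
    (v w : 'rV[C]_d) :
  dotmx v v = 1 -> w *m proj_ortho v = dotmx w v *: v.
Proof.
move=> v1; rewrite -[in LHS](subrK (dotmx w v *: v) w) mulmxDl.
rewrite [X in _ + X]proj_ortho_id ?scalemx_sub // proj_ortho_0 ?add0r //.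
by rewrite orthomxE -/(dotmx _ _) linearBl linearZl_LR /= v1 mulr1 subrr.
Qed.

Lemma proj_ortho_stable (C : numClosedFieldType) (d : nat) (c : C)
    (v : 'rV[C]_d) (W : {vspace 'rV[C]_d}) :
  c != 0 -> dotmx v v = 1 ->
  (op (c *: proj_ortho v) @: W <= W)%VS <-> v \in W \/ v \in orthocompl W.
Proof.
move=> c0 v1.
have opE w : op (c *: proj_ortho v) w = (c * dotmx w v) *: v.
  by rewrite lfunE /= -scalemxAr mulmx_proj_ortho_unit // scalerA.
split=> [stableW | vWW].
  case: (boolP (v \in W)) => [vW | vNW]; [by left | right].
  (* Any w in W with <w, v> != 0 would force v, a multiple of its image,
     into W. *)
  apply/mem_orthovP => w wW; apply/eqP; rewrite herm_eq0C.
  apply: contraNT vNW => wv0.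
  have := subvP stableW _ (memv_img (op (c *: proj_ortho v)) wW).
  by rewrite opE rpredZeq mulf_eq0 (negPf c0) (negPf wv0).
apply/subvP => _ /memv_imgP[w wW ->]; rewrite opE.
case: vWW => [vW | /mem_orthovP vWo]; first exact: memvZ.
have /eqP -> : dotmx w v == 0 by rewrite herm_eq0C vWo.
by rewrite mulr0 scale0r mem0v.
Qed.

Theorem proposition8 (R : realType) (d k : nat) (hd : (2 <= d)%N)
    (Pi : 'I_k -> 'M[R[i]]_d) (phi : 'I_k -> 'rV[R[i]]_d)
    (hPi : rank1_povm Pi) (hphi : associated_vectors Pi phi)
    (W : {vspace 'rV[R[i]]_d}) (hW0 : W != 0%VS) (hW1 : W != fullv) (i : 'I_k) :
  (op (Pi i) @: W <= W)%VS <-> phi i \in W \/ phi i \in orthocompl W.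
Proof.
have [phi1 ->] := hphi i.
apply: proj_ortho_stable phi1.
have k_gt0 : (0 < k)%N by apply: leq_ltn_trans (ltn_ord i).
by rewrite mulf_neq0 ?invr_eq0 // pnatr_eq0 -lt0n // ltnW.
Qed.
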